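(* Colocal connectedness is not a Whitney reversible property; that is, there exists a continuum $X$ such that $X$ is not colocally connected, but for each Whitney map $\mu : C(X) \to [0,\mu(X)]$ and each $t \in (0,\mu(X))$ the continuum $\mu^{-1}(t)$ is colocally connected.
   Context: A continuum is a nonempty compact connected metrizable space; all maps are continuous. A continuum $X$ is colocally connected if for each $x \in X$ and each neighborhood $V \subseteq X$ of $x$ there exists an open neighborhood $U \subseteq X$ of $x$ such that $x \in U \subseteq V$ and $X \setminus U$ is connected (the empty set is regarded as connected). For a continuum $X$, $C(X)$ denotes the space of all nonempty subcontinua of $X$ with the Hausdorff metric. A Whitney map is a continuous map $\mu : C(X) \to [0,\mu(X)]$ such that $\mu(\{x\})=0$ for each $x \in X$ and $\mu(A)<\mu(B)$ whenever $A,B \in C(X)$ and $A \subsetneq B$. It is well known that for each Whitney map $\mu$ and each $t \in [0,\mu(X)]$ the set $\mu^{-1}(t)$ (as a subspace of $C(X)$) is a continuum. A topological property $P$ is a Whitney reversible property provided that whenever $X$ is a continuum such that $\mu^{-1}(t)$ has property $P$ for each Whitney map $\mu$ for $C(X)$ and each $t \in (0,\mu(X))$, then $X$ has property $P$. *)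

(* Defs.v *)
From HB Require Import structures.
From mathcomp Require Import all_boot all_order all_algebra.
From mathcomp Require Import all_classical all_reals all_analysis.

Set Implicit Arguments.
Unset Strict Implicit.
Unset Printing Implicit Defensive.

Import Order.TTheory GRing.Theory Num.Theory.
Import numFieldNormedType.Exports.

Local Open Scope classical_set_scope.
Local Open Scope ring_scope.

Definition subcontinuum {T : topologicalType} (A : set T) : Prop :=
  [/\ A !=set0, compact A & connected A].

(* Metrizability is supplied by the type: a continuum is presented by a metric
   space. The notions below are topological, hence do not depend on which
   compatible metric is used. *)
Definition continuum {R : realType} (X : metricType R) : Prop :=
  subcontinuum [set: X].

(* Meant for continua, but only the topology is used; the empty complement is
   allowed, as connected set0 holds. *)
Definition colocally_connected (T : topologicalType) : Prop :=
  forall (x : T) (V : set T), nbhs x V ->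
    exists U : set T, [/\ open U, U x, U `<=` V & connected (~` U)].

(* The hyperspace C(X) as a type *)
Record hyperspace (R : realType) (X : metricType R) := Hyperspace {
  hyperset :> set X ;
  hyperspaceP : subcontinuum hyperset }.

HB.instance Definition _ (R : realType) (X : metricType R) :=
  gen_eqMixin (hyperspace X).
HB.instance Definition _ (R : realType) (X : metricType R) :=
  gen_choiceMixin (hyperspace X).

Section hausdorff_metric.
Context {R : realType} {X : metricType R}.
Implicit Types A B C : hyperspace X.

Definition thickening (S : set X) (r : R) : set X := \bigcup_(x in S) ball x r.

Definition hausdorff_radii (S T : set X) : set R :=
  [set r | [/\ 0 < r, S `<=` thickening T r & T `<=` thickening S r]].

Definition hausdorff_dist A B : R := inf (hausdorff_radii A B).

Lemma hyperspace_eq A B : hyperset A = hyperset B -> A = B.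
Proof.
case: A B => [A hA] [B hB] /= AB; rewrite AB in hA *.
by congr Hyperspace; exact: Prop_irrelevance.
Qed.

Lemma hyperspace_sub_ball A (x : X) : exists2 r, 0 < r & A `<=` ball x r.
Proof.
have [_ /compact_near_coveringP cA _] := hyperspaceP A.
have /= H := cA R +oo (fun r y => ball x r y) _.
suff : \forall r \near +oo, A `<=` (fun y => ball x r y).
  move=> Ar; have [r [r0 ?]] : exists r, 0 < r /\ A `<=` ball x r.
    apply: (@filter_ex _ (+oo : set_system R)).
    by apply: filterI => //; apply: nbhs_pinfty_gt; exact: num_real.
  by exists r.
apply: H => y _; exists (ball y 1, [set r | mdist x y + 1 < r]).
  by split; [exact: nbhsx_ballx|apply: nbhs_pinfty_gt; exact: num_real].
move=> [z r] /= [yz xyr]; rewrite ballEmdist /=.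
rewrite ballEmdist /= in yz; apply: le_lt_trans (metric_triangle x y z) _.
by apply: lt_trans xyr; rewrite ltrD2l.
Qed.

Lemma hausdorff_radii_neq0 A B : hausdorff_radii A B !=set0.
Proof.
have [[a Aa] _ _] := hyperspaceP A; have [[b Bb] _ _] := hyperspaceP B.
have [r r0 Ar] := hyperspace_sub_ball A b.
have [s s0 Bs] := hyperspace_sub_ball B a.
exists (Num.max r s); split; first by rewrite lt_max r0.
- move=> x /Ar bx; exists b => //; apply: le_ball bx.
  by rewrite le_max lexx.
- move=> x /Bs ax; exists a => //; apply: le_ball ax.
  by rewrite le_max lexx orbT.
Qed.

Lemma hausdorff_radii_lbound A B : has_lbound (hausdorff_radii A B).
Proof. by exists 0 => r [/ltW]. Qed.

Lemma hausdorff_distxx A : hausdorff_dist A A = 0.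
Proof.
apply/eqP; rewrite eq_le; apply/andP; split; last first.
  by apply: lb_le_inf; [exact: hausdorff_radii_neq0|move=> r [/ltW]].
apply/ler_addgt0Pl => e e0; rewrite addr0; apply: ge_inf.
  exact: hausdorff_radii_lbound.
by split => // x Ax; exists x => //; exact: ballxx.
Qed.

Lemma hausdorff_dist_sym A B : hausdorff_dist A B = hausdorff_dist B A.
Proof.
rewrite /hausdorff_dist; congr inf; apply/seteqP.
by split => r [r0 ? ?]; split.
Qed.

Lemma hausdorff_dist_eq0_sub A B : hausdorff_dist A B = 0 -> A `<=` B.
Proof.
move=> AB0 x Ax; have [_ cB _] := hyperspaceP B.
apply: (compact_closed (@metric_hausdorff _ X) cB).
move=> V /nbhs_ballP [e /= e0 xeV].
have [|r [r0 ABr _] re] := @inf_lt _ _ e (hausdorff_radii_neq0 A B).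
  by rewrite -/(hausdorff_dist A B) AB0.
have [y By yx] := ABr _ Ax; exists y; split => //; apply: xeV.
by apply: le_ball (ltW re) _ _; exact: ball_sym.
Qed.

Lemma hausdorff_dist_eq0 A B : hausdorff_dist A B = 0 -> A = B.
Proof.
move=> AB0; apply/hyperspace_eq/seteqP.
by split; apply: hausdorff_dist_eq0_sub => //; rewrite hausdorff_dist_sym.
Qed.

Lemma hausdorff_dist_triangle B A C :
  hausdorff_dist A C <= hausdorff_dist A B + hausdorff_dist B C.
Proof.
apply/ler_addgt0Pr => e e0; have e20 : 0 < e / 2 by rewrite divr_gt0.
have inf' S T : has_inf (hausdorff_radii (hyperset S) (hyperset T)).
  by split; [exact: hausdorff_radii_neq0|exact: hausdorff_radii_lbound].
have [r [r0 AB BA] rAB] := inf_adherent e20 (inf' A B).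
have [s [s0 BC CB] sBC] := inf_adherent e20 (inf' B C).
apply: (@le_trans _ _ (r + s)); last first.
  by rewrite [e]splitr addrACA lerD// ltW.
apply: ge_inf; first exact: hausdorff_radii_lbound.
split; first exact: addr_gt0.
- move=> x /AB[y /BC[z Cz zy] yx]; exists z => //.
  by rewrite addrC; exact: ball_triangle zy yx.
- move=> x /CB[y /BA[z Az zy] yx]; exists z => //.
  exact: ball_triangle zy yx.
Qed.

End hausdorff_metric.

HB.instance Definition _ (R : realType) (X : metricType R) :=
  @isMetric.Build R (hyperspace X) (@hausdorff_dist R X)
    (@hausdorff_distxx R X) (@hausdorff_dist_eq0 R X)
    (@hausdorff_dist_sym R X) (@hausdorff_dist_triangle R X).

Section whitney.
Context {R : realType} {X : metricType R}.

Lemma subcontinuum1 (x : X) : subcontinuum [set x].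
Proof. by split; [exists x|exact: compact_set1|exact: connected1]. Qed.

Definition hyper1 (x : X) : hyperspace X := Hyperspace (subcontinuum1 x).

(* X as an element of C(X) *)
Definition hyperT (cX : continuum X) : hyperspace X := Hyperspace cX.

Definition whitney_map (cX : continuum X) (mu : hyperspace X -> R) : Prop :=
  [/\ continuous mu,
      forall A : hyperspace X, 0 <= mu A <= mu (hyperT cX),
      forall x : X, mu (hyper1 x) = 0 &
      forall A B : hyperspace X, (A : set X) `<` B -> mu A < mu B].

(* mu^-1(t) as a space, with the subspace topology inherited from C(X) *)
Definition whitney_level (mu : hyperspace X -> R) (t : R) : topologicalType :=
  set_type (mu @^-1` [set t]).

End whitney.

(* P is meant to be a topological property, i.e. invariant under
   homeomorphism. *)
Definition whitney_reversible (R : realType) (P : topologicalType -> Prop) :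
    Prop :=
  forall (X : metricType R) (cX : continuum X),
    (forall mu : hyperspace X -> R, whitney_map cX mu ->
      forall t : R, 0 < t < mu (hyperT cX) -> P (whitney_level mu t)) ->
    P X.

(* Main.v *)
(* The example is the bowtie {|y| <= |x| <= 1}, two triangles glued at the apex
   (0, 0), which disconnects it; every other point has arbitrarily small open
   neighborhoods with connected complement.

   An element A of a Whitney level is determined within the level by the points
   off the apex that it contains: any other element B misses a point a <> (0, 0)
   of A. By compactness, the sets {B | B meets W_1, ..., W_n}, with each W_i a
   small neighborhood of such a point, therefore form a neighborhood base at A.
   The complement of such a set is the union of the levels of the continua
   X \ W_i. These are connected, as Whitney levels are, and they pairwise
   intersect, because X minus two small patches W_i and W_j still contains a
   continuum almost as large as X. *)

Require Import Defs.
From HB Require Import structures.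
From mathcomp Require Import all_boot all_order all_algebra.
From mathcomp Require Import finmap ring lra.
From mathcomp Require Import all_classical all_reals all_analysis.

Set Implicit Arguments.
Unset Strict Implicit.
Unset Printing Implicit Defensive.

Import Order.TTheory GRing.Theory Num.Theory.
Import numFieldNormedType.Exports.

Local Open Scope classical_set_scope.
Local Open Scope ring_scope.

(** * The hyperspace of subcontinua *)

Section connectedness.
Context {T : topologicalType}.
Implicit Types A B U V : set T.

Lemma connected_open_disjoint A U V : connected A -> open U -> open V ->
  A `<=` U `|` V -> U `&` V = set0 -> A `&` U !=set0 -> A `<=` U.
Proof.
move=> cA oU oV AUV UV AU.
suff -> : A = A `&` U by apply: subIsetr.
apply/esym/cA => //; first by exists U.
exists (~` V); first exact: open_closedC.
apply/seteqP; split => x [Ax].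
  by move=> Ux; split=> // Vx; have : (U `&` V) x by []; rewrite UV.
by move=> nVx; split => //; case: (AUV _ Ax).
Qed.

Lemma connected_closed_disjoint A U V : connected A -> closed U -> closed V ->
  A `<=` U `|` V -> U `&` V = set0 -> A `&` U !=set0 -> A `<=` U.
Proof.
move=> cA cU cV AUV UV AU.
suff -> : A = A `&` U by apply: subIsetr.
apply/esym/cA => //; last by exists U.
exists (~` V); first exact: closed_openC.
apply/seteqP; split => x [Ax].
  by move=> Ux; split=> // Vx; have : (U `&` V) x by []; rewrite UV.
by move=> nVx; split => //; case: (AUV _ Ax).
Qed.

(** Relatively closed subsets of a closed [A] are closed in the whole space, so only separations by
    ambient closed sets have to be excluded. *)
Lemma closed_connected A : closed A ->
  (forall U V, closed U -> closed V -> U !=set0 -> V !=set0 ->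
    A = U `|` V -> U `&` V = set0 -> False) -> connected A.
Proof.
move=> clA H B B0 [C oC BC] [D cD BD]; apply: contrapT => BA.
apply: (H B (A `&` ~` C)) => //.
- by rewrite BD; exact: closedI.
- by apply: closedI => //; exact: open_closedC.
- apply: contrapT => /set0P/negP/negPn/eqP E; apply: BA.
  apply/seteqP; split=> x; first by rewrite BC => -[].
  move=> Ax; rewrite BC; split => //; apply: contrapT => nC.
  by have : (A `&` ~` C) x by []; rewrite E.
- by rewrite BC -setIUr setUv setIT.
- by rewrite BC; apply/seteqP; split => // x [[_ ?] [_ ]].
Qed.

End connectedness.

Section hyperspace_theory.
Context {R : realType} {X : metricType R}.
Implicit Types (A B D E K M Y : hyperspace X) (S : set X) (e d r : R).

Lemma open_thickening S r : open (thickening S r).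
Proof.
apply: bigcup_open => x _; rewrite openE => y.
rewrite ballEmdist /= => xy; apply/nbhs_ballP.
exists (r - mdist x y) => /=; first by rewrite subr_gt0.
move=> z /=; rewrite !ballEmdist /= => yz.
by apply: le_lt_trans (metric_triangle _ y _) _; rewrite addrC -ltrBrDr.
Qed.

Lemma sub_thickening S r : 0 < r -> S `<=` thickening S r.
Proof. by move=> r0 x Sx; exists x => //; exact: ballxx. Qed.

Lemma hyperspace_compact A : compact A.
Proof. by case: (hyperspaceP A). Qed.

Lemma hyperspace_connected A : connected A.
Proof. by case: (hyperspaceP A). Qed.

Lemma hyperspace_neq0 A : A !=set0.
Proof. by case: (hyperspaceP A). Qed.

Lemma hyperspace_closed A : closed A.
Proof.
by apply: compact_closed (@metric_hausdorff _ X) _; exact: hyperspace_compact.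
Qed.

Lemma ball_hyper_sub A B e : ball A e B -> A `<=` thickening B e.
Proof.
rewrite ballEmdist /= => /(inf_lt (hausdorff_radii_neq0 A B))[r [r0 AB _] re].
by move=> x /AB [y By yx]; exists y => //; apply: le_ball (ltW re) _ yx.
Qed.

(** The distance is an infimum, so inclusions at radius [d] only bound it by [d]; the gap between
    [d] and [e] makes the bound strict. *)
Lemma hyper_ball A B e d : 0 < d -> d < e -> A `<=` thickening B d ->
  B `<=` thickening A d -> ball A e B.
Proof.
move=> d0 de AB BA; rewrite ballEmdist /=; apply: le_lt_trans de.
by apply: ge_inf => //; exact: hausdorff_radii_lbound.
Qed.

(** Some ball of radius [r] about a point of [A] misses [B]; moving each continuum by less than
    [r / 2] cannot close this gap. *)
Lemma nsub_near A B : ~ (A `<=` B) ->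
  exists2 e, 0 < e & forall A' B', ball A e A' -> ball B e B' -> ~ (A' `<=` B').
Proof.
move/existsNP => [x /not_implyP[Ax nBx]].
have /nbhs_ballP[r /= r0 xr] : nbhs x (~` B).
  by apply: open_nbhs_nbhs; split => //; apply: closed_openC;
    exact: hyperspace_closed.
exists (r / 2) => [|A' B' AA' /ball_sym BB' A'B']; first by rewrite divr_gt0.
have [y /A'B' B'y yx] := ball_hyper_sub AA' Ax.
have [z Bz zy] := ball_hyper_sub BB' B'y.
by apply: (xr z) => //; rewrite [r]splitr; apply: ball_triangle;
  apply: ball_sym; eassumption.
Qed.

Lemma closed_subset_of B : closed [set A : hyperspace X | A `<=` B].
Proof.
rewrite -openC openE => A /= /nsub_near[e e0 H].
apply/nbhs_ballP; exists e => //= A' AA'; apply: H AA' _; exact: ballxx.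
Qed.

Lemma closed_superset_of A : closed [set B : hyperspace X | A `<=` B].
Proof.
rewrite -openC openE => B /= /nsub_near[e e0 H].
apply/nbhs_ballP; exists e => //= B' BB'; apply: H BB'; exact: ballxx.
Qed.

(** Compactness of [P] turns the neighborhoods of [A] given by [nsub_near], one for each [B], into a
    single one. *)
Lemma closed_below (P : set (hyperspace X)) : compact P ->
  closed [set A : hyperspace X | exists2 B, P B & A `<=` B].
Proof.
move=> /compact_near_coveringP cP; rewrite -openC openE => A /= nA.
have := cP _ (nbhs A) (fun A' B => ~ (A' `<=` B)) _ _.
move=> H; apply: filterS (H _ _) => [A' PA' [B /PA']//|].
move=> B PB; have /nsub_near[e e0 He] : ~ A `<=` B by move=> AB; apply: nA; exists B.
exists (ball B e, ball A e); first by split; exact: nbhsx_ballx.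
by move=> [B' A'] /= [BB' AA']; exact: He.
Qed.

(** * Compactness of the hyperspace *)

Section compact_ambient.
Hypothesis cX : compact [set: X].

Lemma closed_compact S : closed S -> compact S.
Proof. by move=> cS; apply: subclosed_compact cS cX _. Qed.

(* The limit of an ultrafilter on the hyperspace is the set of points all of
   whose neighborhoods are met by almost all members. *)
Lemma compact_hyperspace : compact [set: hyperspace X].
Proof.
rewrite compact_ultra => F UF _.
pose L := [set x | forall e, 0 < e -> F [set A : hyperspace X | A `&` ball x e !=set0]].
(* Each point of [K] has a ball that almost all members miss, since [F] is an ultrafilter;
   compactness passes from balls to [K]. *)
have missL (K : set X) : compact K -> K `&` L = set0 ->
    F [set A : hyperspace X | K `<=` ~` A].
  move=> /compact_near_coveringP cK KL.
  have H := cK _ F (fun (A : hyperspace X) x => ~ (A : set X) x) _.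
  apply: H => x Kx.
  have /existsNP[e /not_implyP[e0 nF]] : ~ L x.
    by move=> Lx; have : (K `&` L) x by []; rewrite KL.
  have [//|{}nF] := in_ultra_setVsetC [set A : hyperspace X | A `&` ball x e !=set0] UF.
  exists (ball x e, ~` [set A : hyperspace X | A `&` ball x e !=set0]).
    by split => //; exact: nbhsx_ballx.
  by move=> [y A] /= [xy nA] Ay; apply: nA; exists y.
have clL : closed L.
  move=> x clx e e0; have e20 : 0 < e / 2 by rewrite divr_gt0.
  have [y [Ly xy]] := clx _ (nbhsx_ballx x _ e20).
  apply: filterS (Ly _ e20) => A [z [Az yz]]; exists z; split => //.
  by rewrite [e]splitr; exact: ball_triangle yz.
have L0 : L !=set0.
  apply: contrapT => /set0P/negP/negPn/eqP L0.
  have := missL _ cX; rewrite L0 setI0 => /(_ erefl)/filter_ex[A /= H]; have [a Aa] := hyperspace_neq0 A.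
  exact: (H a).
have inO O : open O -> L `<=` O -> F [set A : hyperspace X | A `<=` O].
  move=> oO LO; have := missL (~` O).
  have /[swap]/[apply] : compact (~` O) by apply/closed_compact/open_closedC.
  have : ~` O `&` L = set0 by apply/seteqP; split => // x [nO /LO].
  move=> /[swap]/[apply]; apply: filterS => A /= H x Ax.
  by apply: contrapT => /H.
have meetO O x : open O -> L x -> O x -> F [set A : hyperspace X | A `&` O !=set0].
  move=> oO Lx Ox; have /nbhs_ballP[e /= e0 xe] : nbhs x O by exact: open_nbhs_nbhs.
  by apply: filterS (Lx _ e0) => A [y [Ay /xe]]; exists y.
have cL : connected L.
  (* Normality gives disjoint open neighborhoods of the two pieces. Almost all members lie in their
     union and meet both, against connectedness. *)
  apply: closed_connected => // U V cU cV [u Uu] [v Vv] LUV UV.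
  have nX := compact_normal (@metric_hausdorff _ X) cX.
  have [U' [V' [oU' oV' UU' VV' UV']]] := (@normal_openP R X).1 nX U V cU cV UV.
  have : F [set A : hyperspace X | A `<=` U' `|` V'].
    apply: inO; first exact: openU.
    by rewrite LUV; apply: setUSS.
  have := meetO U' u oU' _ (UU' _ Uu); rewrite LUV => /(_ (or_introl Uu)) FU.
  have := meetO V' v oV' _ (VV' _ Vv); rewrite LUV => /(_ (or_intror Vv)) FV.
  move=> /(filterI (filterI FU FV))/filter_ex[A [[/= AU [w [Aw V'w]]] AUV]].
  have AU' := connected_open_disjoint (@hyperspace_connected A) oU' oV' AUV UV' AU.
  have : (U' `&` V') w by split=> //; exact: AU'.
  by rewrite UV'.
pose LL : hyperspace X := @Hyperspace R X L (And3 L0 (closed_compact clL) cL).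
exists LL; split => //= W /nbhs_ballP[e /= e0 LW].
have e40 : 0 < e / 2 / 2 by rewrite !divr_gt0.
have e2e : e / 2 < e by rewrite ltr_pdivrMr// ltr_pMr// ltr1n.
have e20 : 0 < e / 2 by rewrite divr_gt0.
have F1 : F [set A : hyperspace X | A `<=` thickening L (e / 2)].
  by apply: inO; [exact: open_thickening|exact: sub_thickening].
have F2 : F [set A : hyperspace X | L `<=` thickening A (e / 2)].
  have /compact_near_coveringP := closed_compact clL.
  move=> /(_ _ F (fun A x => thickening (hyperset A) (e / 2) x) _) H.
  apply: H => x Lx.
  exists (ball x (e / 2 / 2), [set A : hyperspace X | A `&` ball x (e / 2 / 2) !=set0]).
    by split; [exact: nbhsx_ballx|exact: Lx].
  move=> [y A] /= [xy [a [Aa xa]]]; exists a => //.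
  by rewrite [e / 2]splitr; apply: ball_triangle xy; exact: ball_sym.
apply: filterS (filterI F1 F2) => A [/= AL LA]; apply: LW.
exact: hyper_ball e20 e2e _ _.
Qed.

End compact_ambient.
End hyperspace_theory.

(** * Boundary bumping *)

Section bumping.
Context {R : realType} {X : metricType R}.
Hypothesis cX : compact [set: X].

(* Coincidence of components and quasicomponents in compact spaces. *)
Section quasicomponent.
Variables M N : set X.

Definition relatively_clopen : set (set X) :=
  [set C | [/\ closed C, M `<=` C, C `<=` N & closed (N `\` C)]].

Definition quasicomponent : set X := \bigcap_(C in relatively_clopen) C.

Hypotheses (M0 : M !=set0) (cM : connected M) (MN : M `<=` N) (clN : closed N).

Lemma relatively_clopenT : relatively_clopen N.
Proof. by split => //; rewrite setDv; exact: closed0. Qed.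

Lemma relatively_clopenI C D : relatively_clopen C -> relatively_clopen D ->
  relatively_clopen (C `&` D).
Proof.
move=> [cC MC CN cNC] [cD MD DN cND]; split.
- exact: closedI.
- by move=> x Mx; split; [exact: MC|exact: MD].
- by move=> x [/CN].
- by rewrite setDIr; exact: closedU.
Qed.

(** Otherwise the sets [C \ O] form a base of a proper filter. Being closed, they all contain its
    cluster point, which then lies in the quasicomponent but not in [O]. *)
Lemma relatively_clopen_sub_open (O : set X) : open O ->
  quasicomponent `<=` O -> exists2 C, relatively_clopen C & C `<=` O.
Proof.
move=> oO QO; apply: contrapT => /forall2NP H.
have FF : ProperFilter (filter_from relatively_clopen (fun C => C `\` O)).
  apply: filter_from_proper => [|C CC].
    apply: filter_from_filter; first by exists N; exact: relatively_clopenT.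
    move=> C D CC CD; exists (C `&` D); first exact: relatively_clopenI.
    by move=> x [[Cx Dx] nOx].
  have [//|/existsNP[x /not_implyP[Cx nOx]]] := H C.
  by exists x.
have [|x [_ Fx]] := cX FF; first exact: filterT.
have CO C : relatively_clopen C -> (C `\` O) x.
  move=> CC; have cCO : closed (C `\` O).
    by case: CC => ? _ _ _; apply: closedI => //; exact: open_closedC.
  by apply: cCO => W xW; apply: Fx => //; exists C.
have [_] := CO _ relatively_clopenT; apply; apply: QO => C CC.
by case: (CO _ CC).
Qed.

Lemma closed_quasicomponent : closed quasicomponent.
Proof. by apply: closed_bigI => C []. Qed.

Lemma sub_quasicomponent : M `<=` quasicomponent.
Proof. by move=> x Mx C [_ MC _ _]; exact: MC. Qed.

(** If it splits into closed [U] and [V] with [M] inside [U], separate them by open [U'] and [V']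
    and take a clopen [C] inside the union. Then [C \ V'] is still clopen and contains [M], but
    misses [V]. *)
Lemma quasicomponent_connected : connected quasicomponent.
Proof.
apply: closed_connected; first exact: closed_quasicomponent.
move=> U V cU cV U0 V0 QUV UV.
have MUV : M `<=` U `|` V by rewrite -QUV; exact: sub_quasicomponent.
wlog MU : U V cU cV U0 V0 QUV UV MUV / M `&` U !=set0.
  move=> H; have [m Mm] := M0; case: (MUV _ Mm) => Hm.
    by apply: (H U V) => //; exists m.
  by apply: (H V U) => //; [rewrite setUC|rewrite setIC|rewrite setUC|exists m].
have {}MU := connected_closed_disjoint cM cU cV MUV UV MU.
have nX := compact_normal (@metric_hausdorff _ X) cX.
have [U' [V' [oU' oV' UU' VV' UV']]] := (@normal_openP R X).1 nX U V cU cV UV.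
have [||C [cC MC CN cNC] CUV] := @relatively_clopen_sub_open (U' `|` V').
- exact: openU.
- by rewrite QUV; exact: setUSS.
have CE : C `\` V' = C `&` U'.
  apply/seteqP; split => x [Cx].
    by move=> nV; split => //; case: (CUV _ Cx).
  by move=> Ux; split => // Vx; have : (U' `&` V') x by []; rewrite UV'.
have CC' : relatively_clopen (C `\` V').
  split.
  - by apply: closedI => //; exact: open_closedC.
  - by move=> x Mx; rewrite CE; split; [exact: MC|apply/UU'/MU].
  - by move=> x [/CN].
  - suff -> : N `\` (C `\` V') = (N `\` C) `|` (C `\` U').
      by apply: closedU => //; apply: closedI => //; exact: open_closedC.
    rewrite CE; apply/seteqP; split=> x.
      move=> [Nx nCU]; have [Cx|] := pselect (C x); last by left.
      by right; split => // Ux; apply: nCU.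
    by move=> [[Nx nC]|[Cx nU]]; split; [|by case| exact: CN|by case].
have [v Vv] := V0.
have : (C `\` V') v by have : quasicomponent v; [rewrite QUV; right|apply].
by case=> _; apply; exact: VV'.
Qed.

End quasicomponent.

Lemma closure_thickening (S : set X) (d : R) : 0 < d ->
  closure (thickening S (d / 2)) `<=` thickening S d.
Proof.
move=> d0 x clx; have d20 : 0 < d / 2 by rewrite divr_gt0.
have [y [[m Sm my] xy]] := clx _ (nbhsx_ballx x _ d20).
exists m => //; rewrite [d]splitr; apply: ball_triangle my _.
exact: ball_sym.
Qed.

(** The candidate is the quasicomponent [Q] of [M] in the part of [B] within the closure of a
    thinner thickening. If [Q] is no larger than [M], then [B] itself is that thin and serves as
    [K]. *)
Lemma exists_larger_subcontinuum (M B : hyperspace X) (d : R) :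
  (M : set X) `<` B -> 0 < d ->
  exists K : hyperspace X,
    [/\ (M : set X) `<` K, K `<=` B & K `<=` thickening M d].
Proof.
move=> [MB BM] d0; have d20 : 0 < d / 2 by rewrite divr_gt0.
pose O := thickening M (d / 2).
pose N := B `&` closure O.
have MO : M `<=` O by exact: sub_thickening.
have clN : closed N.
  by apply: closedI; [exact: hyperspace_closed|exact: closed_closure].
have MN : M `<=` N by move=> x Mx; split; [exact: MB|exact/subset_closure/MO].
have NMd : N `<=` thickening M d by move=> x [_ /(closure_thickening d0)].
have M0 := hyperspace_neq0 M.
have cM := @hyperspace_connected _ _ M.
pose Q := quasicomponent M N.
have cQ : connected Q by exact: quasicomponent_connected.
have clQ : closed Q by exact: closed_quasicomponent.
have MQ : M `<=` Q by exact: sub_quasicomponent.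
have QN : Q `<=` N by move=> x Qx; apply: Qx; exact: relatively_clopenT.
have Q0 : Q !=set0 by case: M0 => m /MQ; exists m.
pose QQ : hyperspace X := Hyperspace (And3 Q0 (closed_compact cX clQ) cQ).
have [QM|nQM] := pselect (Q `<=` M); last first.
  exists QQ; split => //; [by move=> x /QN[]|by move=> x /QN/NMd].
have [|C [cC MC CN cNC] CO] := @relatively_clopen_sub_open M N MN clN O (open_thickening _ _).
  by move=> x /QM/MO.
(* Since [C] stays inside the open set [O], it is clopen in all of [B] and not only in [N];
   connectedness then forces [B] into [C]. *)
have BC : B `\` C = (N `\` C) `|` (B `\` O).
  apply/seteqP; split=> x.
    move=> [Bx nCx]; have [Ox|nO] := pselect (O x); last by right.
    by left; split=> //; split => //; exact: subset_closure.
  by move=> [[[Bx _] nC]|[Bx nO]]; split => // /CO.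
have BsubC : B `<=` C.
  apply: (@connected_closed_disjoint _ _ _ (B `\` C)) => //.
  - exact: hyperspace_connected.
  - rewrite BC; apply: closedU => //; apply: closedI; first exact: hyperspace_closed.
    exact/open_closedC/open_thickening.
  - by move=> x Bx; have [|] := pselect (C x); [left|right].
  - by apply/seteqP; split => // x [? []].
  - by case: M0 => m Mm; exists m; split; [exact: MB|exact: MC].
by exists B; split => // x /BsubC/CN/NMd.
Qed.

End bumping.

(** * Connectedness of Whitney levels *)

Section whitney_levels.
Context {R : realType} {X : metricType R}.
Hypothesis cX : continuum X.
Variable mu : hyperspace X -> R.
Hypothesis wmu : whitney_map cX mu.
Implicit Types A B D E K M Y : hyperspace X.

Let compX : compact [set: X].
Proof. by case: cX. Qed.

Lemma whitney_continuous : continuous mu.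
Proof. by case: wmu. Qed.

Lemma whitney_lt A B : (A : set X) `<` B -> mu A < mu B.
Proof. by case: wmu => _ _ _; apply. Qed.

Lemma whitney_eq A B : A `<=` B -> mu B <= mu A -> A = B.
Proof.
move=> AB BA; apply/hyperspace_eq/seteqP; split => //.
apply: contrapT => nBA; have : mu A < mu B by apply: whitney_lt.
by rewrite ltNge BA.
Qed.

Lemma whitney_lt_thickening D t : mu D < t ->
  exists2 d, 0 < d & forall K, D `<=` K -> K `<=` thickening D d -> mu K < t.
Proof.
move=> Dt; have : nbhs D [set K | mu K < t].
  apply: open_nbhs_nbhs; split => //.
  by apply: (@open_comp _ _ mu [set r | r < t]) => [? _|];
    [exact: whitney_continuous|exact: open_lt].
move=> /nbhs_ballP[d /= d0 dD]; exists (d / 2); first by rewrite divr_gt0.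
move=> K DK KD; apply: dD; apply: (@hyper_ball _ _ _ _ _ (d / 2)) => //.
- by rewrite divr_gt0.
- by rewrite ltr_pdivrMr// ltr_pMr// ltr1n.
- apply: subset_trans DK _; apply: sub_thickening.
  by rewrite divr_gt0.
Qed.

Lemma closed_hyper_max (S : set (hyperspace X)) : closed S -> S !=set0 ->
  exists2 E, S E & forall A, S A -> mu A <= mu E.
Proof.
move=> cS S0; have [||E ES Emax] := @compact_EVT_max _ R mu S S0.
- exact: subclosed_compact cS (compact_hyperspace compX) _.
- by apply: continuous_subspaceT; exact: whitney_continuous.
- by exists E; [exact: set_mem|move=> A SA; apply/Emax/mem_set].
Qed.

(** Among the continua between [M] and [Y] of size at most [t], one of maximal size has size [t]:
    otherwise boundary bumping enlarges it slightly, still below [t]. *)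
Lemma whitney_intermediate M Y t : M `<=` Y -> mu M <= t -> t <= mu Y ->
  exists E, [/\ M `<=` E, E `<=` Y & mu E = t].
Proof.
move=> MY Mt tY.
pose S := [set E : hyperspace X | M `<=` E] `&`
          [set E : hyperspace X | E `<=` Y] `&` (mu @^-1` [set r | r <= t]).
have [||E [[ME EY] /= Et] Emax] := @closed_hyper_max S.
- apply: closedI; first by apply: closedI;
    [exact: closed_superset_of|exact: closed_subset_of].
  by apply: preimage_closed; [move=> ? _; exact: whitney_continuous|exact: closed_le].
- by exists M; split => //; split.
exists E; split => //; apply/eqP; rewrite eq_le Et /= leNgt; apply/negP => {}Et.
have [d d0 dE] := whitney_lt_thickening Et.
have EltY : (E : set X) `<` Y.
  split => // YE; have EY' : E = Y by apply/hyperspace_eq/seteqP.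
  by move: Et; rewrite EY' ltNge tY.
have [K [EK KY KE]] := exists_larger_subcontinuum compX EltY d0.
have := whitney_lt EK; rewrite ltNge Emax//; split; first split => //.
  by apply: subset_trans ME _; case: EK.
by apply/ltW/dE => //; case: EK.
Qed.

Lemma subcontinuumU A B : A `&` B !=set0 -> subcontinuum (A `|` B).
Proof.
move=> AB; split.
- by case: (hyperspace_neq0 A) => a Aa; exists a; left.
- by apply: compactU; exact: hyperspace_compact.
- by apply: connectedU => //; exact: hyperspace_connected.
Qed.

Definition level_in Y t : set (hyperspace X) :=
  [set B : hyperspace X | B `<=` Y /\ mu B = t].

Lemma closed_level_in Y t : closed (level_in Y t).
Proof.
have -> : level_in Y t =
    [set B : hyperspace X | B `<=` Y] `&` mu @^-1` [set r | r = t] by [].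
apply: closedI; first exact: closed_subset_of.
apply: (@preimage_closed _ _ mu); last exact: closed_eq.
by move=> ? _; exact: whitney_continuous.
Qed.

(* If the level splits as P `|` Q, take D of maximal size among the continua
   lying below both P and Q, say D `<=` B1 in P and D `<=` B2 in Q. Growing D
   slightly inside B1 to K1 and inside B2 to K2 and enlarging K1 `|` K2 to a
   member E of the level contradicts the maximality of D, whichever of P and Q
   contains E. *)
Lemma level_in_connected Y t : 0 <= t -> t <= mu Y -> connected (level_in Y t).
Proof.
move=> t0 tY; apply: closed_connected; first exact: closed_level_in.
move=> P Q cP cQ [P1 PP1] [Q1 QQ1] LPQ PQ.
have compP : compact P by exact: subclosed_compact cP (compact_hyperspace compX) _.
have compQ : compact Q by exact: subclosed_compact cQ (compact_hyperspace compX) _.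
pose below (S : set (hyperspace X)) :=
  [set A : hyperspace X | exists2 B, S B & A `<=` B].
have clbP : closed (below P) by exact: closed_below.
have clbQ : closed (below Q) by exact: closed_below.
have LP B : P B -> level_in Y t B by rewrite LPQ; left.
have LQ B : Q B -> level_in Y t B by rewrite LPQ; right.
have mu1 x : mu (hyper1 x) = 0 by case: wmu.
have hyper1c : continuous (hyper1 : X -> hyperspace X).
  move=> x W /nbhs_ballP[e /= e0 eW]; apply/nbhs_ballP; exists (e / 2) => /=.
    by rewrite divr_gt0.
  move=> y xy; apply: eW; apply: (@hyper_ball _ _ _ _ _ (e / 2)).
  - by rewrite divr_gt0.
  - by rewrite ltr_pdivrMr// ltr_pMr// ltr1n.
  - by move=> _ ->; exists y => //; exact: ball_sym.
  - by move=> _ ->; exists x.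
(* Every singleton in [Y] grows to a member of the level, so it lies below [P] or below [Q]. If none
   lay below both, this would separate the connected set [Y]. *)
have [D0 [D0P D0Q]] : below P `&` below Q !=set0.
  apply: contrapT => /set0P/negP/negPn/eqP PQ0.
  have YP : Y `<=` hyper1 @^-1` below P.
    apply: (@connected_closed_disjoint _ _ _ (hyper1 @^-1` below Q)).
    - exact: hyperspace_connected.
    - by apply: preimage_closed => // ? _; exact: hyper1c.
    - by apply: preimage_closed => // ? _; exact: hyper1c.
    - move=> y Yy; have [|||E [yE EY Et]] := @whitney_intermediate (hyper1 y) Y t.
      + by move=> _ ->.
      + by rewrite mu1.
      + exact: tY.
      have : level_in Y t E by [].
      by rewrite LPQ => -[PE|QE]; [left|right]; exists E.
    - apply/seteqP; split => // y [yP yQ].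
      by have : (below P `&` below Q) (hyper1 y) by []; rewrite PQ0.
    - have [p Pp] := hyperspace_neq0 P1; exists p; split.
        by have [+ _] := LP _ PP1; apply.
      by exists P1 => // _ ->.
  have [q Qq] := hyperspace_neq0 Q1.
  have : (below P `&` below Q) (hyper1 q).
    split; last by exists Q1 => // _ ->.
    by apply: YP; have [+ _] := LQ _ QQ1; apply.
  by rewrite PQ0.
have [||D [[B1 PB1 DB1] [B2 QB2 DB2]] Dmax] :=
  @closed_hyper_max (below P `&` below Q).
- exact: closedI.
- by exists D0.
have [B1Y B1t] := LP _ PB1; have [B2Y B2t] := LQ _ QB2.
have B12 : B1 <> B2.
  by move=> E; have : (P `&` Q) B1 by [split=> //; rewrite E]; rewrite PQ.
(* Were [B1] inside [D], it would be inside [B2], and nested continua of equal size coincide. *)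
have ltB1 : (D : set X) `<` B1.
  split => // B1D; apply: B12; apply: whitney_eq; last by rewrite B1t B2t.
  exact: subset_trans DB2.
have ltB2 : (D : set X) `<` B2.
  split => // B2D; apply/B12/esym/whitney_eq; last by rewrite B1t B2t.
  exact: subset_trans DB1.
have Dt : mu D < t by rewrite -B1t; exact: whitney_lt.
have [d d0 dD] := whitney_lt_thickening Dt.
have [K1 [DK1 K1B1 K1D]] := exists_larger_subcontinuum compX ltB1 d0.
have [K2 [DK2 K2B2 K2D]] := exists_larger_subcontinuum compX ltB2 d0.
have K12 : K1 `&` K2 !=set0.
  have [x Dx] := hyperspace_neq0 D; exists x.
  by case: DK1 DK2 => [+ _] [+ _] => /(_ _ Dx) ? /(_ _ Dx).
pose K := Hyperspace (subcontinuumU K12).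
have [|||E [KE EY Et]] := @whitney_intermediate K Y t.
- by rewrite /= subUset; split; [apply: subset_trans B1Y|apply: subset_trans B2Y].
- apply/ltW/dD => /=; last by rewrite subUset.
  by move=> x Dx; left; case: DK1 => + _; apply.
- exact: tY.
have : level_in Y t E by [].
rewrite LPQ => -[PE|QE].
- have := whitney_lt DK2; rewrite ltNge Dmax//; split; last by exists B2.
  by exists E => // x K2x; apply: KE; right.
- have := whitney_lt DK1; rewrite ltNge Dmax//; split; first by exists B1.
  by exists E => // x K1x; apply: KE; left.
Qed.

End whitney_levels.

(** * Colocal connectedness of Whitney levels *)

(** Whitney levels and the bowtie are subtypes, while connectedness is established in the ambient
    space; this transfers it to the subtype. *)
Lemma connected_set_type (T : topologicalType) (A C : set T) :
  C `<=` A -> connected C -> connected (set_val @^-1` C : set A).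
Proof.
move=> CA cC B [b Bb] [G [H' oH' H'E] BG] [F cF BF].
have [F' oF' F'E] := closed_openC cF.
have BE (x : A) : B x <-> C (set_val x) /\ H' (set_val x).
  by rewrite BG -H'E.
have CE : C `&` H' = C.
  apply: cC; first by exists (set_val b); apply/BE.
    by exists H'.
  exists (~` F'); first exact: open_closedC.
  apply/seteqP; split => x [Cx].
    have xA : x \in A by apply/mem_set/CA.
    move=> H'x; split => // F'x.
    have : B (exist _ x xA) by apply/BE.
    rewrite BF => -[_ Fx]; have : (set_val @^-1` F') (exist _ x xA : A) by [].
    by rewrite F'E.
  move=> nF'x; split => //; have xA : x \in A by apply/mem_set/CA.
  have [_] // : C x /\ H' x.
  apply: (BE (exist _ x xA)).1; rewrite BF; split => //.
  by apply: contrapT => nF; apply: nF'x;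
    have : (~` F) (exist _ x xA : A) by []; rewrite -F'E.
apply/seteqP; split => x; first by move/BE => [].
by move=> Cx; apply/BE; move: Cx; rewrite /preimage /= -{1}CE.
Qed.

Section colocal_connectedness.
Context {R : realType} {X : metricType R}.
Hypothesis cX : continuum X.
Variable mu : hyperspace X -> R.
Hypothesis wmu : whitney_map cX mu.
Implicit Types A B D E K M Y Z : hyperspace X.

Let compX : compact [set: X].
Proof. by case: cX. Qed.

Lemma whitney_le A B : A `<=` B -> mu A <= mu B.
Proof.
move=> AB; have [BA|nBA] := pselect (B `<=` A).
  by rewrite (_ : A = B)//; apply/hyperspace_eq/seteqP.
by apply/ltW/(whitney_lt wmu).
Qed.

(** A [d]-dense continuum is Hausdorff-close to the whole space, where [mu] is continuous. *)
Lemma whitney_gt_dense t : t < mu (hyperT cX) ->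
  exists2 d, 0 < d & forall Z, [set: X] `<=` thickening Z d -> t < mu Z.
Proof.
move=> tX; have : nbhs (hyperT cX) [set K | t < mu K].
  apply: open_nbhs_nbhs; split => //.
  by apply: (@open_comp _ _ mu [set r | t < r]) => [? _|];
    [exact: (whitney_continuous wmu)|exact: open_gt].
move=> /nbhs_ballP[d /= d0 dD]; have d20 : 0 < d / 2 by rewrite divr_gt0.
exists (d / 2) => // Z ZX; apply: dD; apply: (@hyper_ball _ _ _ _ _ (d / 2)) => //.
- by rewrite ltr_pdivrMr// ltr_pMr// ltr1n.
- by apply: (@subset_trans _ [set: X]) => //; exact: sub_thickening.
Qed.

(** [Ws] abstracts the small neighborhoods of points other than [p]. The continua [Z] make the
    levels of any two complements meet, and [p] may be left out because continua of positive size do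
    not reduce to a point. *)
Lemma whitney_level_colocally_connected (t : R) (p : X) (Ws : set (set X)) :
  0 < t ->
  (forall W, Ws W -> open W /\ connected (~` W)) ->
  (forall W W', Ws W -> Ws W' -> exists Z,
    [/\ Z `<=` ~` W, Z `<=` ~` W' & t <= mu Z]) ->
  (forall a V, a != p -> nbhs a V -> exists W, [/\ Ws W, W a & W `<=` V]) ->
  colocally_connected (whitney_level mu t).
Proof.
move=> t0 Wcont WZ Wsmall x V [V1 [[V' oV' V'E] V1x V1V]].
pose A : hyperspace X := set_val x.
have At : mu A = t by have := set_valP x.
have V'A : V' A by rewrite /A; move: V1x; rewrite -V'E.
pose miss W := [set B : hyperspace X | B `<=` ~` W].
have sC W : Ws W -> subcontinuum (~` W).
  move=> WW; have [oW cW] := Wcont _ WW; have [Z [ZW _ _]] := WZ _ _ WW WW.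
  split => //; last by apply: closed_compact => //; exact: open_closedC.
  by have [z /ZW] := hyperspace_neq0 Z; exists z.
have clmiss W : Ws W -> closed (miss W).
  by move=> /sC sW; exact: (@closed_subset_of _ _ (Hyperspace sW)).
pose L W := miss W `&` [set B : hyperspace X | mu B = t].
have LL W W' : Ws W -> Ws W' -> L W `&` L W' !=set0.
  move=> WW WW'; have [Z [ZW ZW' Zt]] := WZ _ _ WW WW'.
  have [z Zz] := hyperspace_neq0 Z.
  have [|||E [_ EZ Et]] := @whitney_intermediate _ _ cX _ wmu (hyper1 z) Z t.
  - by move=> _ ->.
  - by case: wmu => _ _ -> _; exact: ltW.
  - by [].
  - by exists E; split; split => //; apply: subset_trans EZ _.
have Lconn W : Ws W -> connected (L W).
  move=> WW; have sW := sC _ WW; have [Z [ZW _ Zt]] := WZ _ _ WW WW.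
  apply: (@level_in_connected _ _ cX _ wmu (Hyperspace sW)); first exact: ltW.
  by apply: le_trans Zt _; exact: whitney_le.
pose S := [set B : hyperspace X | mu B = t] `\` V'.
have cS : compact S.
  apply: subclosed_compact (compact_hyperspace compX) _ => //.
  apply: closedI; last exact: open_closedC.
  apply: (@preimage_closed _ _ mu [set r | r = t]); last exact: closed_eq.
  by move=> ? _; exact: (whitney_continuous wmu).
pose good := Ws `&` [set W | A `&` W !=set0].
have Scover : S `<=` cover good (fun W => (miss W)°).
  move=> B [Bt nV'B].
  have nAB : ~ (A `<=` B).
    move=> AB; apply: nV'B; rewrite -(whitney_eq wmu AB)//.
    by rewrite At Bt.
  (* If [p] were the only point of [A] outside [B], the closed sets [[set p]] and [B] would separate
     [A] unless [A] is [[set p]], whose size is 0 and not [t]. *)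
  have [a [Aa nBa ap]] : exists a, [/\ (A : set X) a, ~ (B : set X) a & a != p].
    apply: contrapT => H.
    have Ap : A `\` B `<=` [set p].
      move=> a [Aa nBa]; apply: contrapT => /eqP ap; apply: H.
      by exists a.
    have [q [Aq nBq]] : exists q, (A : set X) q /\ ~ (B : set X) q.
      by apply: contrapT => nq; apply: nAB => q Aq; apply: contrapT => nBq;
        apply: nq; exists q.
    have qp : q = p by exact: Ap.
    have A1 : A `<=` [set p].
      apply: (@connected_closed_disjoint _ _ _ (B : set X)).
      - exact: hyperspace_connected.
      - exact/(compact_closed (@metric_hausdorff _ X))/compact_set1.
      - exact: hyperspace_closed.
      - move=> y Ay; have [By|nBy] := pselect ((B : set X) y); first by right.
        by left; exact: Ap.
      - by apply/seteqP; split => // y [->]; rewrite -qp.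
      - by exists q; split.
    have : A = hyper1 p.
      by apply: hyperspace_eq; apply/seteqP; split => //= _ ->; rewrite -qp.
    move=> Ap1; have := At; rewrite Ap1; case: wmu => _ _ -> _ t00.
    by move: t0; rewrite -t00 ltxx.
  have /nbhs_ballP[r /= r0 ar] : nbhs a (~` (B : set X)).
    by apply: open_nbhs_nbhs; split => //; apply: closed_openC; exact: hyperspace_closed.
  have r20 : 0 < r / 2 by rewrite divr_gt0.
  have [W [WW Wa Wr]] := Wsmall a _ ap (nbhsx_ballx a _ r20).
  exists W; first by split => //; exists a.
  apply/nbhs_ballP; exists (r / 2) => // B' /ball_sym BB' b B'b Wb.
  have [c Bc cb] := ball_hyper_sub BB' B'b.
  apply: (ar c) => //; rewrite [r]splitr; apply: ball_triangle (Wr _ Wb) _.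
  exact: ball_sym.
(* The covering form of compactness is stated for pointed spaces; [A] serves as the base point. *)
pose pH : ptopologicalType := HB.pack_for ptopologicalType (hyperspace X)
  (isPointed.Build (hyperspace X) A).
have covS : @cover_compact pH S by rewrite -compact_cover.
have [|I Igood SI] := covS _ good _ _ Scover.
  by move=> W _; exact: open_interior.
have gI (W : set X) : [set` I] W -> good W by move=> WI; exact/set_mem/Igood.
pose U0 := ~` \bigcup_(W in [set` I]) miss W.
exists (set_val @^-1` U0); split.
- exists U0 => //; apply: closed_openC; apply: closed_bigcup => //.
  by move=> W /gI[/clmiss].
- by move=> [W /gI[_ [a [Aa Wa]]] /(_ a Aa)].
- move=> B U0B; apply: V1V; rewrite -V'E /=; apply: contrapT => nV'B.
  have [|W IW mB] := SI (set_val B).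
    by split => //; exact: (set_valP B).
  by apply: U0B; exists W => //; exact: interior_subset.
- have -> : ~` (set_val @^-1` U0) =
      set_val @^-1` (\bigcup_(W in [set` I]) L W) :> set (whitney_level mu t).
    rewrite preimage_setC /U0 setCK; apply/seteqP; split => B /= [W IW mB].
      by exists W => //; split => //; exact: (set_valP B).
    by exists W => //; case: mB.
  apply: connected_set_type; first by move=> B [W _ []].
  have [[W0 IW0]|I0] := pselect ([set` I] !=set0); last first.
    rewrite (_ : \bigcup_(W in _) _ = set0); first exact: connected0.
    by apply/seteqP; split => // B [W IW _]; apply: I0; exists W.
  have [W0s _] := gI _ IW0.
  (* The sets [L W] only meet pairwise; joining each one to the fixed [L W0] keeps it connected and
     provides a point common to all. *)
  rewrite (_ : \bigcup_(W in _) _ = \bigcup_(W in [set` I]) (L W0 `|` L W)).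
    have [B0 [LB0 _]] := LL _ _ W0s W0s.
    apply: bigcup_connected; first by exists B0 => W _; left.
    by move=> W /gI[WW _]; apply: connectedU; [exact: LL|exact: Lconn|exact: Lconn].
  apply/seteqP; split => B [W IW LB]; first by exists W => //; right.
  by case: LB => LB; [exists W0|exists W].
Qed.

End colocal_connectedness.

(** * The bowtie *)

Lemma compact_set_type (T : topologicalType) (A : set T) :
  compact A -> compact [set: A].
Proof.
move=> cA F FF _.
have FA : F (set_val @^-1` A).
  by apply: filterS filterT => x _; exact: (set_valP x).
have [p [Ap Gp]] := cA (set_val @ F) (fmap_proper_filter set_val FF) FA.
have pA : p \in A by exact/mem_set.
exists (exist _ p pA); split => // S N FS [_ [[V oV <-] Vp] VN].
have FS' : F (set_val @^-1` (set_val @` S)) by apply: filterS FS => s Ss; exists s.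
have [_ [[s Ss <-] Vs]] := Gp _ V FS' (open_nbhs_nbhs (conj oV Vp)).
by exists s; split => //; exact: VN.
Qed.

Definition bowtie_set (R : realType) : set (R * R) :=
  [set q | `|q.2| <= `|q.1| /\ `|q.1| <= 1].

Arguments bowtie_set : clear implicits.

Definition bowtie (R : realType) := set_type (bowtie_set R).

HB.instance Definition _ (R : realType) := PseudoMetric.on (bowtie R).

Section bowtie_metric.
Variable R : realType.
Implicit Types p q : bowtie R.

(** The maximum metric has exactly the balls that the bowtie inherits from the product [R * R], so
    the two structures agree. *)
Let dist p q : R :=
  Num.max `|(set_val p).1 - (set_val q).1| `|(set_val p).2 - (set_val q).2|.

Let dist_ge0 p q : 0 <= dist p q.
Proof. by rewrite le_max normr_ge0. Qed.

Let dist_positivity p q : dist p q = 0 -> p = q.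
Proof.
move=> pq0; apply: val_inj => /=.
have : dist p q <= 0 by rewrite pq0.
rewrite /dist ge_max !normr_le0 !subr_eq0 => /andP[/eqP p1 /eqP p2].
by rewrite [LHS]surjective_pairing [RHS]surjective_pairing p1 p2.
Qed.

Let ballEdist p e : ball p e = [set q | dist p q < e].
Proof.
by apply/seteqP; split=> q; rewrite /dist /= gt_max => /andP.
Qed.

HB.instance Definition _ :=
  @PseudoMetric_isMetric.Build R (bowtie R) dist dist_ge0 dist_positivity
    ballEdist.

End bowtie_metric.

(* Of three slopes spaced by 2 e, each open interval of length 2 e contains at
   most one, so one of the three avoids both intervals. *)
Lemma slope_avoiding (R : realFieldType) (m a b e : R) : 0 < e -> 4 * e <= 1 ->
  `|m| <= 1 -> exists n, [/\ `|n| <= 1, e <= `|n - a|, e <= `|n - b| &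
    `|n - m| <= 4 * e].
Proof.
move=> e0 e1 m1.
(* The three slopes are [m], [m + 2 * s * e] and [m + 4 * s * e]. The sign [s] is opposite to that
   of [m], so that they stay in [[-1, 1]]. *)
have [s [s1 ms]] : exists s : R, (s = 1 \/ s = -1) /\ `|m + 4 * s * e| <= 1.
  move: m1; rewrite ler_norml => /andP[m1 m2]; have [m0|m0] := leP 0 m.
    by exists (-1); split; [right|rewrite ler_norml; apply/andP; split; lra].
  by exists 1; split; [left|rewrite ler_norml; apply/andP; split; lra].
have far c : `|m - c| < e \/ `|m + 2 * s * e - c| < e \/ `|m + 4 * s * e - c| < e ->
    [\/ [/\ `|m - c| < e, e <= `|m + 2 * s * e - c| & e <= `|m + 4 * s * e - c|],
        [/\ e <= `|m - c|, `|m + 2 * s * e - c| < e & e <= `|m + 4 * s * e - c|] |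
        [/\ e <= `|m - c|, e <= `|m + 2 * s * e - c| & `|m + 4 * s * e - c| < e]].
  by rewrite !ltr_norml !ler_normr; case: s1 => ->; move=> [|[]] /andP[? ?];
    [constructor 1|constructor 2|constructor 3|
     constructor 1|constructor 2|constructor 3]; split; lra.
have m2s : `|m + 2 * s * e| <= 1.
  move: m1 ms; rewrite !ler_norml => /andP[? ?] /andP[? ?].
  by apply/andP; split; lra.
have d0 : `|m - m| <= 4 * e by rewrite subrr normr0; lra.
have d2 : `|m + 2 * s * e - m| <= 4 * e.
  by rewrite ler_norml; case: s1 => ->; apply/andP; split; lra.
have d4 : `|m + 4 * s * e - m| <= 4 * e.
  by rewrite ler_norml; case: s1 => ->; apply/andP; split; lra.
have [a1|a1] := ltP `|m - a| e.
  have [|[_ a2 a4]|[]|[]] := far a; [by left| |by rewrite leNgt a1|by rewrite leNgt a1].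
  have [b1|b1] := ltP `|m + 2 * s * e - b| e; last by exists (m + 2 * s * e).
  exists (m + 4 * s * e); split => //.
  by have [|[]|[]|[_ + _]] := far b; [by right; left|by []|by []|rewrite leNgt b1].
have [b1|b1] := ltP `|m - b| e; last by exists m.
have [|[_ b2 b4]|[]|[]] := far b; [by left| |by rewrite leNgt b1|by rewrite leNgt b1].
have [a2|a2] := ltP `|m + 2 * s * e - a| e; last by exists (m + 2 * s * e).
exists (m + 4 * s * e); split => //.
by have [|[]|[]|[_ + _]] := far a; [by right; left|by []|by []|rewrite leNgt a2].
Qed.

Lemma continuous_pair (T U V : topologicalType) (f : T -> U) (g : T -> V) :
  continuous f -> continuous g -> continuous (fun x => (f x, g x)).
Proof.
move=> cf cg x A [[B C] [/= fB gC] BCA].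
have xB : nbhs x (f @^-1` B) := cf x B fB.
have xC : nbhs x (g @^-1` C) := cg x C gC.
by apply: filterS (filterI xB xC) => y [By Cy]; exact: BCA.
Qed.

Section real_continuity.
Variables (R : realType) (T : topologicalType) (f g : T -> R).
Hypotheses (cf : continuous f) (cg : continuous g).

Lemma continuous_dist_cst (c : R) : continuous (fun x => `|f x - c|).
Proof. by move=> x; apply: cvg_norm; apply: cvgB; [exact: cf|exact: cvg_cst]. Qed.

Lemma continuous_cone_gap (c e : R) :
  continuous (fun x => e * `|f x| - `|g x - c * f x|).
Proof.
move=> x; apply: cvgB.
  by apply: cvgM; [exact: cvg_cst|apply: cvg_norm; exact: cf].
apply: cvg_norm; apply: cvgB; first exact: cg.
by apply: cvgM; [exact: cvg_cst|exact: cf].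
Qed.

End real_continuity.

(** * Rays, patches and fans in the bowtie *)

Section bowtie_theory.
Variable R : realType.
Implicit Types p q : bowtie R.
Implicit Types m x e r : R.

Definition abscissa q : R := (set_val q).1.
Definition ordinate q : R := (set_val q).2.

Lemma bowtie_eq p q : abscissa p = abscissa q -> ordinate p = ordinate q ->
  p = q.
Proof.
rewrite /abscissa /ordinate => p1 p2; apply: val_inj => /=.
by rewrite [LHS]surjective_pairing [RHS]surjective_pairing p1 p2.
Qed.

Lemma continuous_abscissa : continuous abscissa.
Proof.
move=> q; apply: continuous_comp; first exact: initial_continuous.
exact: cvg_fst.
Qed.

Lemma continuous_ordinate : continuous ordinate.
Proof.
move=> q; apply: continuous_comp; first exact: initial_continuous.
exact: cvg_snd.
Qed.

Lemma ball_bowtie p e q : `|abscissa p - abscissa q| < e ->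
  `|ordinate p - ordinate q| < e -> ball p e q.
Proof. by move=> pq1 pq2; rewrite ballEmdist /mdist /= gt_max pq1 pq2. Qed.

Lemma abscissa_le1 q : `|abscissa q| <= 1.
Proof. by have [_] := set_valP q. Qed.

(** Abscissa and slope are the working coordinates. Every slope fits the apex, where 0 is chosen. *)
Lemma bowtie_slope q : exists2 m, `|m| <= 1 & ordinate q = m * abscissa q.
Proof.
have [+ _] := set_valP q; rewrite -/(abscissa q) -/(ordinate q) => yx.
have [x0|x0] := eqVneq (abscissa q) 0.
  exists 0; first by rewrite normr0.
  by move: yx; rewrite x0 normr0 normr_le0 => /eqP ->; rewrite mul0r.
exists (ordinate q / abscissa q); last by rewrite divfK.
by rewrite normrM normfV ler_pdivrMr ?mul1r// normr_gt0.
Qed.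

Lemma mem_bowtie_set x m : `|x| <= 1 -> `|m| <= 1 -> (bowtie_set R) (x, m * x).
Proof.
move=> x1 m1; split => //=; rewrite normrM.
by rewrite -[leRHS]mul1r ler_wpM2r.
Qed.

Lemma bowtie_point x m : `|x| <= 1 -> `|m| <= 1 ->
  exists q, abscissa q = x /\ ordinate q = m * x.
Proof.
move=> x1 m1; have qB : (x, m * x) \in bowtie_set R.
  by apply/mem_set/mem_bowtie_set.
by exists (exist (fun z => z \in bowtie_set R) _ qB).
Qed.

Let zero_bowtie : (0, 0) \in bowtie_set R.
Proof. by apply/mem_set; rewrite /bowtie_set /= normr0. Qed.

Definition apex : bowtie R :=
  exist (fun z => z \in bowtie_set R) _ zero_bowtie.

Lemma abscissa_eq0 q : abscissa q = 0 -> q = apex.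
Proof.
move=> q0; have [m _ qm] := bowtie_slope q.
by apply: bowtie_eq; rewrite ?qm q0 ?mulr0.
Qed.

Definition ray m : set (bowtie R) := [set q | ordinate q = m * abscissa q].

Definition vertical x : set (bowtie R) := [set q | abscissa q = x].

Lemma ray_connected m : `|m| <= 1 -> connected (ray m).
Proof.
move=> m1; have cf : continuous (fun x : R => (x, m * x)).
  apply: continuous_pair => x; first exact: cvg_id.
  by apply: cvgM; [exact: cvg_cst|exact: cvg_id].
have fB : (fun x : R => (x, m * x)) @` `[-1, 1] `<=` bowtie_set R.
  move=> _ [x /= + <-]; rewrite in_itv /= -ler_norml => x1.
  exact: mem_bowtie_set.
have -> : ray m = set_val @^-1` ((fun x : R => (x, m * x)) @` `[-1, 1]).
  apply/seteqP; split => q /=.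
    rewrite /ray /= => qm; exists (abscissa q).
      by rewrite /= in_itv /= -ler_norml abscissa_le1.
    by rewrite -qm /abscissa /ordinate -surjective_pairing.
  by move=> [x _ E]; rewrite /ray /= /abscissa /ordinate -E.
apply: connected_set_type => //; apply: connected_continuous_connected.
  exact: segment_connected.
exact: continuous_subspaceT.
Qed.

Lemma vertical_connected x : `|x| <= 1 -> connected (vertical x).
Proof.
move=> x1; have cf : continuous (fun m : R => (x, m * x)).
  apply: continuous_pair => m; first exact: cvg_cst.
  by apply: cvgM; [exact: cvg_id|exact: cvg_cst].
have fB : (fun m : R => (x, m * x)) @` `[-1, 1] `<=` bowtie_set R.
  move=> _ [m /= + <-]; rewrite in_itv /= -ler_norml => m1.
  exact: mem_bowtie_set.
have -> : vertical x = set_val @^-1` ((fun m : R => (x, m * x)) @` `[-1, 1]).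
  apply/seteqP; split => q /=.
    rewrite /vertical /= => qx; have [m m1 qm] := bowtie_slope q; exists m.
      by rewrite /= in_itv /= -ler_norml.
    by rewrite -qx -qm /abscissa /ordinate -surjective_pairing.
  by move=> [m _ E]; rewrite /vertical /= /abscissa -E.
apply: connected_set_type => //; apply: connected_continuous_connected.
  exact: segment_connected.
exact: continuous_subspaceT.
Qed.

(** All the sets [f q] share the apex. The connected subsets of the bowtie below are obtained by
    joining each point to it. *)
Lemma star_connected (C : set (bowtie R)) (f : bowtie R -> set (bowtie R)) :
  (forall q, C q -> [/\ connected (f q), f q `<=` C, f q q & f q apex]) ->
  connected C.
Proof.
move=> Cf; have -> : C = \bigcup_(q in C) f q.
  apply/seteqP; split => q; first by move=> Cq; exists q => //; case: (Cf _ Cq).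
  by move=> [p Cp]; case: (Cf _ Cp) => _ + _ _; apply.
apply: bigcup_connected => [|q Cq]; last by case: (Cf _ Cq).
by exists apex => q Cq; case: (Cf _ Cq).
Qed.

Lemma ray_apex m : ray m apex.
Proof. by rewrite /ray /= /abscissa /ordinate /= mulr0. Qed.

Lemma bowtie_continuum : continuum (bowtie R).
Proof.
split; first by exists apex.
  apply: compact_set_type.
  apply: (@subclosed_compact _ (bowtie_set R)
    ([set` `[-1, 1]] `*` [set` `[-1, 1]] : set (R * R)%type)).
  - have -> : bowtie_set R =
        (fun q : R * R => `|q.2| - `|q.1|) @^-1` [set r | r <= 0] `&`
        (fun q : R * R => `|q.1|) @^-1` [set r | r <= 1].
      by apply/seteqP; split => q; rewrite /bowtie_set /= subr_le0.
    apply: closedI; (apply: preimage_closed; last exact: closed_le) => q _.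
      by apply: cvgB; apply: cvg_norm; [exact: cvg_snd|exact: cvg_fst].
    by apply: cvg_norm; exact: cvg_fst.
  - by apply: compact_setX; exact: segment_compact.
  - move=> q [yx x1]; split; rewrite /= in_itv /= -ler_norml //.
    exact: le_trans x1.
(* [xget] selects a slope of [q]; its default case is ruled out by [bowtie_slope]. *)
apply: (@star_connected _ (fun q => ray (xget 0 [set m | `|m| <= 1 /\ ray m q]))).
move=> q _; case: xgetP => [m _ [m1 qm]|H].
  by split => //; [exact: ray_connected|exact: ray_apex].
by have [m m1 qm] := bowtie_slope q; case: (H m).
Qed.

(** The complement of a small neighborhood of the apex reaches abscissas -1 and 1. If connected, it
    would also reach abscissa 0, which only the apex has. *)
Lemma bowtie_not_colocally_connected : ~ colocally_connected (bowtie R).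
Proof.
have V : nbhs apex [set q | `|abscissa q| < 1].
  apply/nbhs_ballP; exists 1 => //= q; rewrite ballEmdist /mdist /= gt_max.
  by rewrite sub0r normrN => /andP[].
move=> /(_ _ _ V)[U [oU Ua UV cU]].
have /connected_intervalP itvU : connected (abscissa @` ~` U).
  apply: connected_continuous_connected => //.
  by apply: continuous_subspaceT; exact: continuous_abscissa.
have mem x : `|x| = 1 -> (abscissa @` ~` U) x.
  move=> x1; have [||q [qx _]] := @bowtie_point x 0; rewrite ?x1 ?normr0//.
  by exists q => // /UV /=; rewrite qx x1 ltxx.
have [|||q nUq q0] := itvU (-1) 1 _ _ 0.
- by apply: mem; rewrite normrN normr1.
- by apply: mem; rewrite normr1.
- by rewrite lerN10 ler01.
by apply: nUq; rewrite (abscissa_eq0 q0).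
Qed.

(** A box in abscissa and slope: off the apex the second condition says that the slope is within [e]
    of [m0]. Written without division, its strictness excludes the apex. *)
Definition patch x0 m0 e : set (bowtie R) :=
  [set q | `|abscissa q - x0| < e /\
           `|ordinate q - m0 * abscissa q| < e * `|abscissa q|].

Lemma continuous_slope_gap m0 e :
  continuous (fun q => e * `|abscissa q| - `|ordinate q - m0 * abscissa q|).
Proof.
apply: continuous_cone_gap;
  [exact: continuous_abscissa|exact: continuous_ordinate].
Qed.

Lemma open_patch x0 m0 e : open (patch x0 m0 e).
Proof.
apply: openI.
  apply: (@open_comp _ _ (fun q => `|abscissa q - x0|) [set r | r < e]);
    last exact: open_lt.
  by move=> q _; apply: continuous_dist_cst; exact: continuous_abscissa.
rewrite [X in open X](_ : _ =
    (fun q => e * `|abscissa q| - `|ordinate q - m0 * abscissa q|) @^-1`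
    [set r | 0 < r]).
  apply: open_comp; last exact: open_gt.
  by move=> q _; exact: continuous_slope_gap.
by apply/seteqP; split => q /=; rewrite subr_gt0.
Qed.

Lemma ray_patch x0 m0 e m q : ray m q -> patch x0 m0 e q -> `|m - m0| < e.
Proof.
rewrite /ray /patch /= => -> [_]; rewrite -mulrBl normrM.
have [->|x0n] := eqVneq (abscissa q) 0; first by rewrite normr0 !mulr0 ltxx.
by rewrite ltr_pM2r// normr_gt0.
Qed.

(** A point whose slope is far from [m0] reaches the apex along its ray. Any other point of the
    complement has abscissa far from [x0]: it moves vertically to a ray of far slope [m1] and
    follows that one. *)
Lemma patchC_connected x0 m0 e : 0 < e -> e <= `|x0| -> e <= 1 -> `|m0| <= 1 ->
  connected (~` patch x0 m0 e).
Proof.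
move=> e0 ex e1 m01.
(* The endpoint of [[-1, 1]] on the other side of 0 is at distance at least 1 from [m0]. *)
have [m1 m11 m1e] : exists2 m1, `|m1| <= 1 & e <= `|m1 - m0|.
  have [m0p|m0n] := leP 0 m0.
    exists (-1); first by rewrite normrN normr1.
    by rewrite ler_normr; apply/orP; right; lra.
  by exists 1; [rewrite normr1|rewrite ler_normr; apply/orP; left; lra].
have rayC m : e <= `|m - m0| -> ray m `<=` ~` patch x0 m0 e.
  by move=> me q mq /(ray_patch mq); rewrite ltNge me.
(* The hypothesis on [q] sits under the existential so that [choice] yields a function defined at
   every point. *)
suff H q : exists C, ~ patch x0 m0 e q ->
    [/\ connected C, C `<=` ~` patch x0 m0 e, C q & C apex].
  by have [f fH] := choice H; exact: star_connected fH.
have [m ml1 qm] := bowtie_slope q.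
have [me|me] := leP e `|m - m0|.
  exists (ray m) => _; split => //;
    [exact: ray_connected|exact: rayC|exact: ray_apex].
exists (vertical (abscissa q) `|` ray m1) => nq.
have xe : e <= `|abscissa q - x0|.
  rewrite leNgt; apply/negP => xe; apply: nq; split => //.
  rewrite qm -mulrBl normrM ltr_pM2r// normr_gt0; apply/eqP => x00.
  by move: xe; rewrite x00 sub0r normrN ltNge ex.
split; [|rewrite subUset; split|by left|by right; exact: ray_apex].
- apply: connectedU.
  + have [p [pa po]] := bowtie_point (abscissa_le1 q) m11.
    by exists p; split => //; rewrite /ray /= po pa.
  + exact/vertical_connected/abscissa_le1.
  + exact: ray_connected.
- by move=> p /= pq [+ _]; rewrite pq ltNge xe.
- exact: rayC.
Qed.

(* The points on the rays of slopes m with |m - a| >= e and |m - b| >= e. *)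
Definition fan a b e : set (bowtie R) :=
  [set q | e * `|abscissa q| <= `|ordinate q - a * abscissa q| /\
           e * `|abscissa q| <= `|ordinate q - b * abscissa q|].

Lemma ray_fan a b e m : e <= `|m - a| -> e <= `|m - b| -> ray m `<=` fan a b e.
Proof.
move=> ma mb q; rewrite /ray /= => qm; rewrite /fan /= qm -!mulrBl !normrM.
by split; apply: ler_wpM2r.
Qed.

Lemma fan_subcontinuum a b e : subcontinuum (fan a b e).
Proof.
have [_ cX _] := bowtie_continuum.
split.
- by exists apex; rewrite /fan /= !normr0 !mulr0.
- apply: closed_compact => //; apply: closedI.
    rewrite [X in closed X](_ : _ =
      (fun q => e * `|abscissa q| - `|ordinate q - a * abscissa q|) @^-1`
      [set r | r <= 0]); last by apply/seteqP; split => q /=; rewrite subr_le0.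
    apply: preimage_closed; last exact: closed_le.
    by move=> q _; exact: continuous_slope_gap.
  rewrite [X in closed X](_ : _ =
    (fun q => e * `|abscissa q| - `|ordinate q - b * abscissa q|) @^-1`
    [set r | r <= 0]); last by apply/seteqP; split => q /=; rewrite subr_le0.
  apply: preimage_closed; last exact: closed_le.
  by move=> q _; exact: continuous_slope_gap.
- suff H q : exists C, fan a b e q ->
      [/\ connected C, C `<=` fan a b e, C q & C apex].
    by have [f fH] := choice H; exact: star_connected fH.
  (* At the apex the inequalities of the fan do not constrain the slope, so the singleton replaces
     the ray. *)
  have [q0|q0] := eqVneq (abscissa q) 0.
    exists [set q] => Fq; split => //; [exact: connected1|by move=> _ ->|].
    by rewrite /= (abscissa_eq0 q0).
  have [m ml1 qm] := bowtie_slope q; exists (ray m).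
  rewrite /fan /= qm -!mulrBl !normrM !ler_pM2r ?normr_gt0// => -[ma mb].
  by split => //; [exact: ray_connected|exact: ray_fan|exact: ray_apex].
Qed.

(** A vertical move to the slope given by [slope_avoiding] leads into the fan; as abscissas are at
    most 1 in absolute value, it covers at most [4 * e]. *)
Lemma fan_dense a b e r : 0 < e -> 4 * e <= 1 -> 4 * e < r ->
  [set: bowtie R] `<=` thickening (fan a b e) r.
Proof.
move=> e0 e1 er q _; have [m m1 qm] := bowtie_slope q.
have [n [n1 na nb nm]] := slope_avoiding a b e0 e1 m1.
have [p [pa po]] := bowtie_point (abscissa_le1 q) n1.
exists p; first by apply: (ray_fan na nb); rewrite /ray /= po pa.
apply: ball_bowtie; first by rewrite pa subrr normr0; lra.
rewrite po qm -mulrBl normrM; apply: le_lt_trans er.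
by apply: le_trans nm; rewrite -[leRHS]mulr1 ler_wpM2l// abscissa_le1.
Qed.

Lemma fan_patch x0 a b e e' : e' <= e -> fan a b e `<=` ~` patch x0 a e'.
Proof.
move=> ee q [qa _] [_]; rewrite ltNge => /negP; apply.
by apply: le_trans qa; rewrite ler_wpM2r.
Qed.

Lemma fanC a b e : fan a b e = fan b a e.
Proof. by apply/seteqP; split => q []. Qed.

Lemma small_patch (a : bowtie R) (V : set (bowtie R)) e : 0 < e -> a != apex ->
  nbhs a V -> exists x0 m0 e', [/\ 0 < e' <= e, e' <= `|x0|, `|m0| <= 1,
    patch x0 m0 e' a & patch x0 m0 e' `<=` V].
Proof.
move=> e0 a0 /nbhs_ballP[r /= r0 arV]; have [m m1 am] := bowtie_slope a.
have xa0 : 0 < `|abscissa a|.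
  by rewrite normr_gt0; apply: contra a0 => /eqP/abscissa_eq0 ->.
(* The bound by the abscissa serves [patchC_connected]; [r / 2] is there because the ordinate varies
   both through the slope and through the abscissa. *)
pose e' := Num.min e (Num.min `|abscissa a| (r / 2)).
have e'0 : 0 < e' by rewrite !lt_min e0 xa0 divr_gt0.
have e'e : e' <= e by rewrite ge_min lexx.
have e'x : e' <= `|abscissa a| by rewrite !ge_min lexx orbT.
have e'r : e' <= r / 2 by rewrite !ge_min lexx !orbT.
exists (abscissa a), m, e'; split => //; first by rewrite e'0.
  by split; rewrite ?am subrr normr0// mulr_gt0.
move=> q [qx qy]; apply: arV; apply: ball_bowtie; rewrite distrC.
  by apply: lt_le_trans qx _; lra.
have -> : ordinate q - ordinate a = (ordinate q - m * abscissa q) +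
    m * (abscissa q - abscissa a) by rewrite am; ring.
apply: le_lt_trans (ler_normD _ _) _; rewrite [r]splitr.
apply: ltr_leD.
  apply: lt_le_trans qy _; apply: le_trans e'r.
  by rewrite -[leRHS]mulr1 ler_wpM2l ?abscissa_le1// ltW.
rewrite normrM; apply: le_trans e'r; rewrite -[leRHS]mul1r.
by apply: ler_pM => //; exact: ltW.
Qed.

End bowtie_theory.

Theorem mainTheorem4 (R : realType) :
  ~ whitney_reversible R colocally_connected /\
  exists (X : metricType R) (cX : continuum X),
    ~ colocally_connected X /\
    forall mu : hyperspace X -> R, whitney_map cX mu ->
      forall t : R, 0 < t < mu (hyperT cX) ->
        colocally_connected (whitney_level mu t).
Proof.
suff H : forall mu : hyperspace (bowtie R) -> R,
    whitney_map (@bowtie_continuum R) mu ->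
    forall t : R, 0 < t < mu (hyperT (@bowtie_continuum R)) ->
      colocally_connected (whitney_level mu t).
  split; last first.
    exists (bowtie R), (@bowtie_continuum R); split => //.
    exact: bowtie_not_colocally_connected.
  by move=> /(_ _ _ H); exact: bowtie_not_colocally_connected.
move=> mu wmu t /andP[t0 tX]; have [d d0 dZ] := whitney_gt_dense wmu tX.
(* The bound [1 / 4] leaves room for three slopes in [slope_avoiding], and [d / 8] makes fans
   [d]-dense, hence of size above [t]. *)
pose e := Num.min (1 / 4) (d / 8).
have e0 : 0 < e by rewrite lt_min !divr_gt0.
have e1 : 4 * e <= 1.
  have : e <= 1 / 4 by rewrite ge_min lexx.
  by lra.
have ed : 4 * e < d.
  have : e <= d / 8 by rewrite ge_min lexx orbT.
  by lra.
pose Ws := [set W : set (bowtie R) | exists x0 m0 e',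
  [/\ 0 < e' <= e, e' <= `|x0|, `|m0| <= 1 & W = patch x0 m0 e']].
apply: (whitney_level_colocally_connected wmu (p := apex R) (Ws := Ws)) => //.
- move=> _ [x0 [m0 [e' [/andP[e'0 e'e] ex m01 ->]]]].
  by split; [exact: open_patch|apply: patchC_connected => //; lra].
- move=> W W' [x0 [m0 [e' [/andP[_ e'e] _ _ ->]]]].
  move=> [x0' [m0' [e'' [/andP[_ e''e] _ _ ->]]]].
  (* One fan avoids both patches, since its slopes keep distance [e] from both central slopes and
     neither patch is wider. *)
  exists (Hyperspace (fan_subcontinuum m0 m0' e)); split.
  + exact: fan_patch.
  + by rewrite /= fanC; exact: fan_patch.
  + by apply/ltW/dZ; exact: fan_dense.
- move=> a V a0 /(small_patch e0 a0)[x0 [m0 [e' [ee ex m01 Pa PV]]]].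
  by exists (patch x0 m0 e'); split => //; exists x0, m0, e'.
Qed.
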